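(* Let $p:\mathbb{E}\to\mathbb{B}$ be a fibred type-theoretic fibration category, $\mathbb{A}$ a type-theoretic fibration category and $F:\mathbb{A}\to\mathbb{B}$ a functor preserving fibrations, pullbacks of fibrations and acyclic cofibrations. Then the change of base $F^*\mathbb{E}\to\mathbb{A}$ of $p$ along $F$ is a fibred type-theoretic fibration category where the fibrations are the levelwise fibrations: a morphism $(s,f):(I,A)\to(J,B)$ in $F^*\mathbb{E}$ is a fibration if and only if $s$ and $f$ are fibrations.
   Context: A morphism $i:A\to B$ has the left lifting property with respect to $q:C\to D$ if for all $f:A\to C$, $g:B\to D$ with $qf=gi$ there is $h:B\to C$ with $hi=f$ and $qh=g$. A type-theoretic fibration category is a category $\mathbb{C}$ with a terminal object $1$ and a subcategory whose morphisms are called fibrations, such that (an acyclic cofibration being a morphism with the left lifting property with respect to all fibrations): (i) all isomorphisms and all morphisms with codomain $1$ are fibrations; (ii) pullbacks of fibrations along arbitrary morphisms exist and are fibrations; (iii) every morphism factors as an acyclic cofibration followed by a fibration; (iv) for any fibrations $f:A\to B$ and $g:B\to C$ there is a fibration $\Pi_gf:\Pi_gA\to C$, called a dependent product of $f$ along $g$, with a natural bijection $(\mathbb{C}/C)(h,\Pi_gf)\cong(\mathbb{C}/B)(g^*h,f)$ for all $h:X\to C$. A type-theoretic functor is a functor between type-theoretic fibration categories preserving terminal objects, fibrations, pullbacks of fibrations, acyclic cofibrations and dependent products. A fibred category $p:\mathbb{E}\to\mathbb{B}$ is a Grothendieck fibration; a morphism $f$ is above $s$ if $pf=s$. A fibred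 type-theoretic fibration category is a fibred category $p:\mathbb{E}\to\mathbb{B}$ such that: (1) $\mathbb{E}$ and $\mathbb{B}$ are type-theoretic fibration categories and $p$ is a type-theoretic functor; (2) every cartesian morphism above a fibration is a fibration; (3) if $g:A\to C$ is a fibration in $\mathbb{E}$, $pg=t\circ s$ with $s:pA\to J$ a fibration and $t:J\to pC$, then the induced morphism $A\to t^*C$ above $s$ is a fibration; (4) every cartesian morphism above an acyclic cofibration is an acyclic cofibration. The change of base $F^*\mathbb{E}\to\mathbb{A}$ is the pullback of $p$ along $F$: objects of $F^*\mathbb{E}$ are pairs $(I,A)$ with $I\in\mathbb{A}$, $A\in\mathbb{E}$, $pA=FI$; morphisms $(I,A)\to(J,B)$ are pairs $(s,f)$ with $s:I\to J$ in $\mathbb{A}$ and $f:A\to B$ in $\mathbb{E}$ above $Fs$; the functor to $\mathbb{A}$ is the first projection. *)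

(* Defs.v *)
From Stdlib Require Import ssrfun ProofIrrelevance.

Set Implicit Arguments.
Unset Strict Implicit.
Unset Printing Implicit Defensive.

(** * Categories and functors *)

Record category := Category {
  ob :> Type;
  hom : ob -> ob -> Type;
  idm : forall X : ob, hom X X;
  compose : forall X Y Z : ob, hom Y Z -> hom X Y -> hom X Z;
  compose_idl : forall (X Y : ob) (f : hom X Y), compose (idm Y) f = f;
  compose_idr : forall (X Y : ob) (f : hom X Y), compose f (idm X) = f;
  compose_assoc : forall (X Y Z W : ob)
      (h : hom Z W) (g : hom Y Z) (f : hom X Y),
    compose h (compose g f) = compose (compose h g) f
}.

Arguments hom {c} X Y.
Arguments idm {c} X.
Arguments compose {c X Y Z} g f.

Notation "g ∘ f" := (compose g f) (at level 40, left associativity).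

Record functor (C D : category) := Functor {
  fob :> C -> D;
  fmap : forall X Y : C, hom X Y -> hom (fob X) (fob Y);
  fmap_id : forall X : C, fmap (idm X) = idm (fob X);
  fmap_comp : forall (X Y Z : C) (g : hom Y Z) (f : hom X Y),
    fmap (g ∘ f) = fmap g ∘ fmap f
}.

Arguments fmap {C D} F {X Y} f : rename.

Definition mor_class (C : category) := forall X Y : C, hom X Y -> Prop.

Definition is_iso (C : category) (X Y : C) (f : hom X Y) : Prop :=
  exists g : hom Y X, g ∘ f = idm X /\ f ∘ g = idm Y.

Definition is_terminal (C : category) (T : C) : Prop :=
  forall X : C, exists! f : hom X T, True.

(** * Pullbacks *)

Definition is_pullback (C : category) (X Y Z P : C)
    (f : hom X Z) (g : hom Y Z) (p1 : hom P X) (p2 : hom P Y) : Prop :=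
  f ∘ p1 = g ∘ p2 /\
  forall (W : C) (u : hom W X) (v : hom W Y), f ∘ u = g ∘ v ->
    exists! w : hom W P, p1 ∘ w = u /\ p2 ∘ w = v.

Record pullback (C : category) (X Y Z : C) (f : hom X Z) (g : hom Y Z) :=
  Pullback {
    pb_ob : C;
    pb_fst : hom pb_ob X;
    pb_snd : hom pb_ob Y;
    pb_is_pullback : is_pullback f g pb_fst pb_snd
  }.

Arguments Pullback {C X Y Z f g pb_ob pb_fst pb_snd} pb_is_pullback.

(** * Slice categories: [slice_hom h k] is the hom-set (C/Z)(h, k) *)

Record slice_hom (C : category) (X Y Z : C) (h : hom X Z) (k : hom Y Z) :=
  SliceHom {
    slice_mor :> hom X Y;
    slice_comm : k ∘ slice_mor = h
  }.

Lemma slice_comp_comm (C : category) (X Y W Z : C)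
    (h : hom X Z) (k : hom Y Z) (l : hom W Z)
    (v : slice_hom k l) (u : slice_hom h k) : l ∘ (v ∘ u) = h.
Proof. now rewrite compose_assoc, (slice_comm v), (slice_comm u). Qed.

Definition slice_comp (C : category) (X Y W Z : C)
    (h : hom X Z) (k : hom Y Z) (l : hom W Z)
    (v : slice_hom k l) (u : slice_hom h k) : slice_hom h l :=
  SliceHom (slice_comp_comm v u).

Lemma slice_map_comm (C D : category) (F : functor C D) (X Y Z : C)
    (h : hom X Z) (k : hom Y Z) (u : slice_hom h k) :
  fmap F k ∘ fmap F u = fmap F h.
Proof. now rewrite <- fmap_comp, (slice_comm u). Qed.

Definition slice_map (C D : category) (F : functor C D) (X Y Z : C)
    (h : hom X Z) (k : hom Y Z) (u : slice_hom h k) :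
    slice_hom (fmap F h) (fmap F k) :=
  SliceHom (slice_map_comm F u).

(** * Dependent products *)

(** A natural bijection (C/Z)(h, pi) ≅ (C/Y)(g^* h, f).  No choice of pullbacks
    is fixed: [g^* h] ranges over the second projections of all pullbacks [Q] of
    [h] and [g].  In [dprod_natural], the square condition says that [m] is the
    morphism [g^* k] induced by [k]; with [k] an identity, it also says that the
    bijection does not depend on the pullback chosen for [g^* h]. *)
Record dprod_bijection (C : category) (X Y Z P : C)
    (f : hom X Y) (g : hom Y Z) (pi : hom P Z) := DprodBijection {
  dprod_fun : forall (W : C) (h : hom W Z) (Q : pullback h g),
    slice_hom h pi -> slice_hom (pb_snd Q) f;
  dprod_bijective : forall (W : C) (h : hom W Z) (Q : pullback h g),
    bijective (dprod_fun Q);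
  dprod_natural : forall (W W' : C) (h : hom W Z) (h' : hom W' Z)
      (Q : pullback h g) (Q' : pullback h' g)
      (k : slice_hom h' h) (m : slice_hom (pb_snd Q') (pb_snd Q)),
    pb_fst Q ∘ m = k ∘ pb_fst Q' ->
    forall u : slice_hom h pi,
      dprod_fun Q' (slice_comp u k) = slice_comp (dprod_fun Q u) m
}.

(** * Type-theoretic fibration categories *)

Definition has_llp (C : category) (A B X Y : C) (i : hom A B) (q : hom X Y) :
    Prop :=
  forall (f : hom A X) (g : hom B Y), q ∘ f = g ∘ i ->
    exists h : hom B X, h ∘ i = f /\ q ∘ h = g.

Definition acyclic_cofibration (C : category) (fib : mor_class C) : mor_class C :=
  fun A B i => forall (X Y : C) (q : hom X Y), fib X Y q -> has_llp i q.

(** The subcategory of fibrations is given by its class of morphisms; it contains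
    every object because isomorphisms are fibrations. *)
Record is_ttfc (C : category) (fib : mor_class C) : Prop := IsTtfc {
  ttfc_terminal : exists T : C, is_terminal T;
  ttfc_fib_comp : forall (X Y Z : C) (g : hom Y Z) (f : hom X Y),
    fib Y Z g -> fib X Y f -> fib X Z (g ∘ f);
  ttfc_fib_iso : forall (X Y : C) (f : hom X Y), is_iso f -> fib X Y f;
  ttfc_fib_terminal : forall (X T : C) (f : hom X T), is_terminal T -> fib X T f;
  ttfc_pullback : forall (X Y Z : C) (f : hom X Z) (g : hom Y Z),
    fib Y Z g -> inhabited (pullback f g);
  ttfc_fib_pullback : forall (X Y Z : C) (f : hom X Z) (g : hom Y Z)
      (Q : pullback f g),
    fib Y Z g -> fib (pb_ob Q) X (pb_fst Q);
  ttfc_factorization : forall (X Y : C) (f : hom X Y),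
    exists (M : C) (i : hom X M) (q : hom M Y),
      acyclic_cofibration fib i /\ fib M Y q /\ f = q ∘ i;
  ttfc_dprod : forall (X Y Z : C) (f : hom X Y) (g : hom Y Z),
    fib X Y f -> fib Y Z g ->
    exists (P : C) (pi : hom P Z),
      fib P Z pi /\ inhabited (dprod_bijection f g pi)
}.

(** * Type-theoretic functors *)

Section Preservation.

Variables (C D : category) (fibC : mor_class C) (fibD : mor_class D).
Variable F : functor C D.

Definition preserves_terminal : Prop :=
  forall T : C, is_terminal T -> is_terminal (F T).

Definition preserves_fibrations : Prop :=
  forall (X Y : C) (f : hom X Y), fibC f -> fibD (fmap F f).

Definition preserves_pullbacks_of_fibrations : Prop :=
  forall (X Y Z P : C) (f : hom X Z) (g : hom Y Z) (p1 : hom P X) (p2 : hom P Y),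
    fibC g -> is_pullback f g p1 p2 ->
    is_pullback (fmap F f) (fmap F g) (fmap F p1) (fmap F p2).

Definition preserves_acyclic_cofibrations : Prop :=
  forall (X Y : C) (i : hom X Y),
    acyclic_cofibration fibC i -> acyclic_cofibration fibD (fmap F i).

(** The image of a dependent product is a dependent product of the images, in such
    a way that [F] commutes with the two natural bijections.  [HQ] says that the
    image of the pullback [Q] is a pullback. *)
Definition preserves_dprods : Prop :=
  forall (X Y Z P : C) (f : hom X Y) (g : hom Y Z) (pi : hom P Z)
      (phi : dprod_bijection f g pi),
    fibC f -> fibC g -> fibC pi ->
    exists psi : dprod_bijection (fmap F f) (fmap F g) (fmap F pi),
      forall (W : C) (h : hom W Z) (Q : pullback h g)
          (HQ : is_pullback (fmap F h) (fmap F g)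
                  (fmap F (pb_fst Q)) (fmap F (pb_snd Q)))
          (u : slice_hom h pi),
        dprod_fun psi (Pullback HQ) (slice_map F u) =
        slice_map F (dprod_fun phi Q u).

Record is_tt_functor : Prop := IsTtFunctor {
  tt_functor_terminal : preserves_terminal;
  tt_functor_fib : preserves_fibrations;
  tt_functor_pullback : preserves_pullbacks_of_fibrations;
  tt_functor_acof : preserves_acyclic_cofibrations;
  tt_functor_dprod : preserves_dprods
}.

End Preservation.

(** * Fibred categories *)

Definition cast_hom (C : category) (X X' Y Y' : C) (eX : X = X') (eY : Y = Y')
    (f : hom X Y) : hom X' Y' :=
  match eX in _ = A, eY in _ = B return hom A B with
  | eq_refl, eq_refl => f
  end.

(** [f : A -> B] is above [s : I -> J], i.e. [p f = s], along the equalities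
    [p A = I] and [p B = J] of objects. *)
Definition above (E B : category) (p : functor E B) (X Y : E) (I J : B)
    (eX : p X = I) (eY : p Y = J) (f : hom X Y) (s : hom I J) : Prop :=
  cast_hom eX eY (fmap p f) = s.

Definition cartesian (E B : category) (p : functor E B) (X Y : E) (f : hom X Y) :
    Prop :=
  forall (Z : E) (g : hom Z Y) (t : hom (p Z) (p X)), fmap p f ∘ t = fmap p g ->
    exists! h : hom Z X, fmap p h = t /\ f ∘ h = g.

Definition is_fibred_category (E B : category) (p : functor E B) : Prop :=
  forall (Y : E) (I : B) (s : hom I (p Y)),
    exists (X : E) (eX : p X = I) (f : hom X Y),
      cartesian p f /\ above eX eq_refl f s.

Record is_fibred_ttfc (E B : category) (fibE : mor_class E) (fibB : mor_class B)
    (p : functor E B) : Prop := IsFibredTtfc {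
  fttfc_fibred : is_fibred_category p;
  fttfc_total : is_ttfc fibE;
  fttfc_base : is_ttfc fibB;
  fttfc_functor : is_tt_functor fibE fibB p;
  fttfc_cartesian_fib : forall (X Y : E) (f : hom X Y),
    cartesian p f -> fibB _ _ (fmap p f) -> fibE _ _ f;
  (* [c : X -> Y] is the cartesian morphism t^* Y -> Y and [a : Z -> X] the morphism
     it induces. *)
  fttfc_induced_fib : forall (Z Y : E) (g : hom Z Y) (J : B)
      (s : hom (p Z) J) (t : hom J (p Y))
      (X : E) (eX : p X = J) (c : hom X Y) (a : hom Z X),
    fibE _ _ g -> fmap p g = t ∘ s -> fibB _ _ s ->
    cartesian p c -> above eX eq_refl c t ->
    above eq_refl eX a s -> c ∘ a = g ->
    fibE _ _ a;
  fttfc_cartesian_acof : forall (X Y : E) (f : hom X Y),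
    cartesian p f -> acyclic_cofibration fibB (fmap p f) ->
    acyclic_cofibration fibE f
}.

(** * Change of base *)

Section ChangeOfBase.

Variables (E B A : category) (p : functor E B) (F : functor A B).

Record cob_ob := CobOb {
  cob_base : A;
  cob_total : E;
  cob_eq : p cob_total = F cob_base
}.

Record cob_hom (X Y : cob_ob) := CobHom {
  cob_base_mor : hom (cob_base X) (cob_base Y);
  cob_total_mor : hom (cob_total X) (cob_total Y);
  cob_above : above (cob_eq X) (cob_eq Y) cob_total_mor (fmap F cob_base_mor)
}.

Lemma cob_hom_eq (X Y : cob_ob) (f g : cob_hom X Y) :
  cob_base_mor f = cob_base_mor g -> cob_total_mor f = cob_total_mor g -> f = g.
Proof.
destruct f as [s f Hf], g as [s' f' Hf']; simpl; intros -> ->.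
now rewrite (proof_irrelevance _ Hf Hf').
Qed.

Lemma above_id (X : E) (I : A) (eX : p X = F I) :
  above eX eX (idm X) (fmap F (idm I)).
Proof. unfold above; rewrite !fmap_id; now destruct eX. Qed.

Lemma above_comp (X Y Z : E) (I J K : A)
    (eX : p X = F I) (eY : p Y = F J) (eZ : p Z = F K)
    (g : hom Y Z) (f : hom X Y) (t : hom J K) (s : hom I J) :
  above eY eZ g (fmap F t) -> above eX eY f (fmap F s) ->
  above eX eZ (g ∘ f) (fmap F (t ∘ s)).
Proof.
unfold above; intros Hg Hf; rewrite !fmap_comp, <- Hg, <- Hf; clear Hg Hf.
now destruct eX, eY, eZ.
Qed.

Definition cob_id (X : cob_ob) : cob_hom X X :=
  CobHom (above_id (cob_eq X)).

Definition cob_comp (X Y Z : cob_ob) (g : cob_hom Y Z) (f : cob_hom X Y) :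
    cob_hom X Z :=
  CobHom (above_comp (cob_above g) (cob_above f)).

Definition change_of_base : category.
Proof.
refine (@Category cob_ob cob_hom cob_id cob_comp _ _ _);
  intros; apply cob_hom_eq; simpl;
  first [apply compose_idl | apply compose_idr | apply compose_assoc].
Defined.

Definition change_of_base_proj : functor change_of_base A :=
  @Functor change_of_base A cob_base cob_base_mor
    (fun _ => eq_refl) (fun _ _ _ _ _ => eq_refl).

Definition levelwise (fibA : mor_class A) (fibE : mor_class E) :
    mor_class change_of_base :=
  fun X Y f => fibA _ _ (cob_base_mor f) /\ fibE _ _ (cob_total_mor f).

End ChangeOfBase.

Arguments levelwise {E B A} p F fibA fibE X Y f.

(* Main.v *)
From Stdlib Require Import ssrfun ProofIrrelevance ClassicalEpsilon.
Require Import Defs.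

(** A levelwise structure on [F^*E] works because in [E] the base component of every
    construction can be prescribed.  The key point is the factorization of [f] above
    a given factorization [p f = q ∘ i]: if [rho] is a retraction of the acyclic
    cofibration [i], the cartesian map [X -> rho^*X] above [i] is an acyclic
    cofibration, and it leaves a vertical map [rho^*X -> q^*Y] to be factored; the
    middle object of any factorization [r ∘ j] of the latter is brought back over the
    base by reindexing along the acyclic cofibration [p j].  Since [F] does not
    preserve terminal objects and dependent products, those of [F^*E] are obtained
    from the ones of [E] by reindexing along the comparison morphisms [F 1 -> p 1]
    and [F (Pi) -> p (Pi)].  Equalities [p X = I] of objects are used only through
    the isomorphisms they induce. *)

Set Implicit Arguments.
Unset Strict Implicit.
Unset Printing Implicit Defensive.

(** * Categories *)

(** [norm] associates composites to the right, so [g ∘ f] followed on the right by a further factor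
    is no longer a subterm; this form lets [rw] rewrite it there. *)
Lemma reassoc (C : category) (X Y Z : C) (g : hom Y Z) (f : hom X Y) (k : hom X Z) :
  g ∘ f = k -> forall (W : C) (x : hom W X), g ∘ (f ∘ x) = k ∘ x.
Proof. intros <- W x; apply compose_assoc. Qed.

Ltac norm := repeat (rewrite <- compose_assoc || rewrite compose_idl
                     || rewrite compose_idr).
Tactic Notation "rw" uconstr(H) :=
  (first [rewrite H | rewrite (reassoc H)]); norm.
Tactic Notation "rwl" uconstr(H) :=
  (first [rewrite <- H | rewrite (reassoc (eq_sym H))]); norm.

Lemma is_iso_idm (C : category) (X : C) : is_iso (idm X).
Proof. exists (idm X); now rewrite compose_idl. Qed.

Lemma is_iso_comp (C : category) (X Y Z : C) (g : hom Y Z) (f : hom X Y) :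
  is_iso g -> is_iso f -> is_iso (g ∘ f).
Proof.
intros [g' [Hg1 Hg2]] [f' [Hf1 Hf2]]; exists (f' ∘ g'); split; norm.
- rw Hg1. exact Hf1.
- rw Hf2. exact Hg2.
Qed.

Lemma iso_monic (C : category) (X Y Z : C) (f : hom Y Z) (a b : hom X Y) :
  is_iso f -> f ∘ a = f ∘ b -> a = b.
Proof.
intros [g [H1 H2]] H.
now rewrite <- (compose_idl a), <- (compose_idl b), <- H1, <- !compose_assoc, H.
Qed.

Lemma fmap_square (C D : category) (F : functor C D) (X Y Y' Z : C)
    (g : hom Y Z) (f : hom X Y) (g' : hom Y' Z) (f' : hom X Y') :
  g ∘ f = g' ∘ f' -> fmap F g ∘ fmap F f = fmap F g' ∘ fmap F f'.
Proof. now rewrite <- !fmap_comp; intros ->. Qed.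

Lemma fmap_triangle (C D : category) (F : functor C D) (X Y Z : C)
    (g : hom Y Z) (f : hom X Y) (k : hom X Z) :
  g ∘ f = k -> fmap F g ∘ fmap F f = fmap F k.
Proof. now rewrite <- fmap_comp; intros ->. Qed.

Lemma terminal_ext (C : category) (T X : C) (f g : hom X T) :
  is_terminal T -> f = g.
Proof.
intros HT; destruct (HT X) as [h [_ Hh]].
now rewrite <- (Hh f I), <- (Hh g I).
Qed.

Lemma terminal_hom (C : category) (T X : C) :
  is_terminal T -> exists f : hom X T, True.
Proof. intros HT; destruct (HT X) as [h _]; now exists h. Qed.

Lemma terminal_iso (C : category) (S T : C) :
  is_terminal S -> is_terminal T -> exists f : hom S T, is_iso f.
Proof.
intros HS HT; destruct (terminal_hom S HT) as [f _], (terminal_hom T HS) as [g _].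
exists f, g; split; now apply terminal_ext.
Qed.

Lemma iso_terminal (C : category) (S T : C) (f : hom S T) :
  is_iso f -> is_terminal S -> is_terminal T.
Proof.
intros [g [H1 H2]] HS X; destruct (terminal_hom X HS) as [k _].
exists (f ∘ k); split; trivial; intros k' _.
rewrite (terminal_ext k (g ∘ k') HS).
now rw H2.
Qed.

(** * Pullbacks *)

Section Pullbacks.

Variables (C : category) (X Y Z : C) (f : hom X Z) (g : hom Y Z).

Lemma pullback_ext (P W : C) (p1 : hom P X) (p2 : hom P Y) (w w' : hom W P) :
  is_pullback f g p1 p2 -> p1 ∘ w = p1 ∘ w' -> p2 ∘ w = p2 ∘ w' -> w = w'.
Proof.
intros [Hc Hu] H1 H2.
destruct (Hu W (p1 ∘ w') (p2 ∘ w')) as [v [_ Hv]].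
- rewrite !compose_assoc; now rewrite Hc.
- now rewrite <- (Hv w), <- (Hv w').
Qed.

Lemma pullback_lift (P W : C) (p1 : hom P X) (p2 : hom P Y)
    (u : hom W X) (v : hom W Y) :
  is_pullback f g p1 p2 -> f ∘ u = g ∘ v ->
  exists w : hom W P, p1 ∘ w = u /\ p2 ∘ w = v.
Proof.
intros [Hc Hu] H; destruct (Hu W u v H) as [w [Hw _]]; now exists w.
Qed.

Lemma pullback_iso (P P' : C) (p1 : hom P X) (p2 : hom P Y) (k : hom P' P) :
  is_pullback f g p1 p2 -> is_iso k -> is_pullback f g (p1 ∘ k) (p2 ∘ k).
Proof.
intros HP Hk; split.
- destruct HP as [Hc _]; now rewrite !compose_assoc, Hc.
- intros W u v H; destruct (pullback_lift HP H) as [w [H1 H2]].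
  destruct (Hk) as [k' [Hk1 Hk2]]; exists (k' ∘ w); split.
  + split; norm; now rw Hk2.
  + intros w' [H1' H2']; apply (iso_monic Hk); rw Hk2.
    apply (pullback_ext HP); norm; rewrite ?H1, ?H2; rewrite ?compose_assoc;
      congruence.
Qed.

Lemma pullback_unique (P P' : C) (p1 : hom P X) (p2 : hom P Y)
    (p1' : hom P' X) (p2' : hom P' Y) :
  is_pullback f g p1 p2 -> is_pullback f g p1' p2' ->
  exists k : hom P P', is_iso k /\ p1' ∘ k = p1 /\ p2' ∘ k = p2.
Proof.
intros HP HP'.
destruct (pullback_lift HP' (proj1 HP)) as [k [H1 H2]].
destruct (pullback_lift HP (proj1 HP')) as [k' [H1' H2']].
exists k; repeat split; trivial; exists k'; split.
- apply (pullback_ext HP); norm; [now rw H1' | now rw H2'].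
- apply (pullback_ext HP'); norm; [now rw H1 | now rw H2].
Qed.

(** The images under [F] and [p] of the two components of a cospan in [F^*E] agree only up to the
    isomorphisms given by equalities of objects; this carries a pullback of one to a pullback of the
    other. *)
Lemma pullback_cospan_iso (X' Y' Z' P : C) (f' : hom X' Z') (g' : hom Y' Z')
    (a : hom X X') (b : hom Y Y') (c : hom Z Z') (p1 : hom P X) (p2 : hom P Y) :
  is_iso a -> is_iso b -> is_iso c -> c ∘ f = f' ∘ a -> c ∘ g = g' ∘ b ->
  is_pullback f g p1 p2 -> is_pullback f' g' (a ∘ p1) (b ∘ p2).
Proof.
intros Ha Hb Hc Hf Hg HP; split.
- rewrite !compose_assoc, <- Hf, <- Hg; norm; f_equal; apply (proj1 HP).
- intros W u v H.
  destruct (Ha) as [a' [Ha1 Ha2]], (Hb) as [b' [Hb1 Hb2]].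
  destruct (@pullback_lift _ _ p1 p2 (a' ∘ u) (b' ∘ v) HP) as [w [H1 H2]].
  + apply (iso_monic Hc); rewrite !compose_assoc, Hf, Hg; norm.
    rw Ha2; now rw Hb2.
  + exists w; split.
    * split; norm; rewrite ?H1, ?H2; [now rw Ha2 | now rw Hb2].
    * intros w' [H1' H2']; apply (pullback_ext HP).
      -- apply (iso_monic Ha); rewrite H1; rw Ha2; now rewrite <- H1'; norm.
      -- apply (iso_monic Hb); rewrite H2; rw Hb2; now rewrite <- H2'; norm.
Qed.

End Pullbacks.

(** * Acyclic cofibrations *)

Section AcyclicCofibrations.

Variables (C : category) (fib : mor_class C).

Lemma acof_comp (X Y Z : C) (j : hom Y Z) (i : hom X Y) :
  acyclic_cofibration fib j -> acyclic_cofibration fib i ->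
  acyclic_cofibration fib (j ∘ i).
Proof.
intros Hj Hi V W q Hq f g H.
destruct (Hi V W q Hq f (g ∘ j)) as [h [H1 H2]]; [now norm |].
destruct (Hj V W q Hq h g H2) as [k [H3 H4]].
exists k; split; trivial; now rw H3.
Qed.

Lemma acof_iso (X Y : C) (i : hom X Y) : is_iso i -> acyclic_cofibration fib i.
Proof.
intros [i' [H1 H2]] V W q Hq f g H; exists (f ∘ i'); split; norm.
- now rw H1.
- rw H; now rw H2.
Qed.

(** [i] is a retract of [j] under [X]: a lift for [j] with lower side [g ∘ r] restricts along
    [s]. *)
Lemma acof_retract (X Y Y' : C) (i : hom X Y) (j : hom X Y')
    (s : hom Y Y') (r : hom Y' Y) :
  acyclic_cofibration fib j -> r ∘ s = idm Y -> s ∘ i = j ->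
  acyclic_cofibration fib i.
Proof.
intros Hj Hrs Hsi V W q Hq f g H.
destruct (Hj V W q Hq f (g ∘ r)) as [h [H1 H2]].
- rewrite <- Hsi; norm; now rw Hrs.
- exists (h ∘ s); split; norm.
  + now rw Hsi.
  + rw H2; now rw Hrs.
Qed.

Hypothesis HC : is_ttfc fib.

(** Every object is fibrant, so the identity of [X] extends along [i] by lifting against the map
    from [X] to a terminal object. *)
Lemma acof_retraction (X Y : C) (i : hom X Y) :
  acyclic_cofibration fib i -> exists r : hom Y X, r ∘ i = idm X.
Proof.
intros Hi; destruct (ttfc_terminal HC) as [T HT].
destruct (terminal_hom X HT) as [x _], (terminal_hom Y HT) as [y _].
destruct (Hi X T x (ttfc_fib_terminal HC _ HT) (idm X) y) as [r [Hr _]].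
- now apply terminal_ext.
- now exists r.
Qed.

Lemma fib_comp_iso (X Y Z : C) (f : hom Y Z) (k : hom X Y) :
  is_iso k -> fib f -> fib (f ∘ k).
Proof.
intros Hk Hf; apply (ttfc_fib_comp HC); trivial; now apply (ttfc_fib_iso HC).
Qed.

Lemma fib_iso_comp (X Y Z : C) (k : hom Y Z) (f : hom X Y) :
  is_iso k -> fib f -> fib (k ∘ f).
Proof.
intros Hk Hf; apply (ttfc_fib_comp HC); trivial; now apply (ttfc_fib_iso HC).
Qed.

Lemma fib_square_iso (X Y X' Y' : C) (f : hom X Y) (f' : hom X' Y')
    (a : hom X X') (b : hom Y Y') :
  is_iso a -> is_iso b -> b ∘ f = f' ∘ a -> fib f' -> fib f.
Proof.
intros Ha [b' [Hb1 Hb2]] H Hf'.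
replace f with (b' ∘ (f' ∘ a)) by (rwl H; now rw Hb1).
apply fib_iso_comp; [now exists b | now apply fib_comp_iso].
Qed.

Lemma acof_square_iso (X Y X' Y' : C) (f : hom X Y) (f' : hom X' Y')
    (a : hom X X') (b : hom Y Y') :
  is_iso a -> is_iso b -> b ∘ f = f' ∘ a -> acyclic_cofibration fib f' ->
  acyclic_cofibration fib f.
Proof.
intros Ha [b' [Hb1 Hb2]] H Hf'.
replace f with (b' ∘ (f' ∘ a)) by (rwl H; now rw Hb1).
apply acof_comp; [apply acof_iso; now exists b |].
apply acof_comp; trivial; now apply acof_iso.
Qed.

End AcyclicCofibrations.

(** * Casts *)

Definition cast_iso (C : category) (X Y : C) (e : X = Y) : hom X Y :=
  cast_hom eq_refl e (idm X).

Lemma cast_iso_symr (C : category) (X Y : C) (e : X = Y) :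
  cast_iso e ∘ cast_iso (eq_sym e) = idm Y.
Proof. destruct e; apply compose_idl. Qed.

Lemma cast_iso_syml (C : category) (X Y : C) (e : X = Y) :
  cast_iso (eq_sym e) ∘ cast_iso e = idm X.
Proof. destruct e; apply compose_idl. Qed.

Lemma is_iso_cast (C : category) (X Y : C) (e : X = Y) : is_iso (cast_iso e).
Proof.
exists (cast_iso (eq_sym e)); split; [apply cast_iso_syml | apply cast_iso_symr].
Qed.

(** Trades the cast for a commuting square in the base, where composites can be rewritten. *)
Lemma above_iff (E B : category) (p : functor E B) (X Y : E) (I J : B)
    (eX : p X = I) (eY : p Y = J) (f : hom X Y) (s : hom I J) :
  above eX eY f s <-> cast_iso eY ∘ fmap p f = s ∘ cast_iso eX.
Proof.
unfold above; destruct eX, eY; unfold cast_iso; simpl.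
now rewrite compose_idl, compose_idr.
Qed.

(** * Cartesian morphisms *)

Section Cartesian.

Variables (E B : category) (p : functor E B).

Lemma cartesian_ext (X Y Z : E) (f : hom X Y) (h h' : hom Z X) :
  cartesian p f -> fmap p h = fmap p h' -> f ∘ h = f ∘ h' -> h = h'.
Proof.
intros Hf Hp H; destruct (Hf Z (f ∘ h') (fmap p h')) as [k [_ Hk]].
- now rewrite fmap_comp.
- now rewrite <- (Hk h), <- (Hk h').
Qed.

Lemma cartesian_lift (X Y Z : E) (f : hom X Y) (g : hom Z Y) (t : hom (p Z) (p X)) :
  cartesian p f -> fmap p f ∘ t = fmap p g ->
  exists h : hom Z X, fmap p h = t /\ f ∘ h = g.
Proof. intros Hf H; destruct (Hf Z g t H) as [h [Hh _]]; now exists h. Qed.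

Lemma cartesian_intro (X Y : E) (f : hom X Y) :
  (forall (Z : E) (g : hom Z Y) (t : hom (p Z) (p X)), fmap p f ∘ t = fmap p g ->
    exists h : hom Z X, fmap p h = t /\ f ∘ h = g) ->
  (forall (Z : E) (h h' : hom Z X), fmap p h = fmap p h' -> f ∘ h = f ∘ h' ->
    h = h') ->
  cartesian p f.
Proof.
intros He Hu Z g t H; destruct (He Z g t H) as [h [H1 H2]].
exists h; split; [now split | intros h' [H1' H2']].
apply Hu; congruence.
Qed.

Lemma cartesian_iso (X Y : E) (f : hom X Y) : is_iso f -> cartesian p f.
Proof.
intros Hf; apply cartesian_intro.
- intros Z g t H; destruct (Hf) as [f' [H1 H2]]; exists (f' ∘ g).
  rewrite fmap_comp, <- H; norm; split.
  + rw (fmap_triangle p H1); rewrite fmap_id; now norm.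
  + now rw H2.
- intros Z h h' _; now apply iso_monic.
Qed.

Lemma cartesian_comp (X Y Z : E) (g : hom Y Z) (f : hom X Y) :
  cartesian p g -> cartesian p f -> cartesian p (g ∘ f).
Proof.
intros Hg Hf; apply cartesian_intro.
- intros W k t; rewrite fmap_comp, <- compose_assoc; intros H.
  destruct (cartesian_lift Hg H) as [h [H1 H2]].
  destruct (cartesian_lift Hf (eq_sym H1)) as [l [H3 H4]].
  exists l; split; trivial; norm; congruence.
- intros W h h' H1 H2; rewrite <- !compose_assoc in H2.
  apply (cartesian_ext Hf H1), (cartesian_ext Hg); trivial.
  now rewrite !fmap_comp, H1.
Qed.

Lemma cartesian_cancel (X Y Z : E) (g : hom Y Z) (f : hom X Y) :
  cartesian p g -> cartesian p (g ∘ f) -> cartesian p f.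
Proof.
intros Hg Hgf; apply cartesian_intro.
- intros W k t H.
  destruct (cartesian_lift (g := g ∘ k) (t := t) Hgf) as [h [H1 H2]].
  + rewrite !fmap_comp; norm; now rewrite H.
  + exists h; split; trivial; apply (cartesian_ext Hg).
    * now rewrite fmap_comp, H1.
    * now rewrite compose_assoc.
- intros W h h' H1 H2; apply (cartesian_ext Hgf H1); norm; now rewrite H2.
Qed.

Lemma cartesian_above_iso (X Y : E) (f : hom X Y) :
  cartesian p f -> is_iso (fmap p f) -> is_iso f.
Proof.
intros Hf [t [H1 H2]].
destruct (cartesian_lift (g := idm Y) (t := t) Hf) as [h [H3 H4]].
- now rewrite fmap_id.
- exists h; split; trivial; apply (cartesian_ext Hf).
  + now rewrite fmap_comp, fmap_id, H3.
  + norm; now rw H4.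
Qed.

Lemma cartesian_lift_exists :
  is_fibred_category p -> forall (Y : E) (I : B) (s : hom I (p Y)),
  exists (X : E) (eX : p X = I) (f : hom X Y),
    cartesian p f /\ fmap p f = s ∘ cast_iso eX.
Proof.
intros Hp Y I s; destruct (Hp Y I s) as [X [eX [f [Hf Ha]]]].
exists X, eX, f; split; trivial.
apply above_iff in Ha; now rewrite <- Ha; unfold cast_iso; simpl; rewrite compose_idl.
Qed.

(** Since [fmap p m] has an inverse [m'], the mediating morphism must lie above [m' ∘ fmap p u]. It
    is obtained from [k], and [d] being cartesian shows that its composite with [m] is [u]. *)
Lemma cartesian_square_pullback (M N V1 V2 : E) (k : hom M N) (d : hom V2 V1)
    (m : hom M V2) (n : hom N V1) :
  cartesian p k -> cartesian p d -> is_iso (fmap p m) -> is_iso (fmap p n) ->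
  d ∘ m = n ∘ k -> is_pullback d n m k.
Proof.
intros Hk Hd Hm Hn Hc; split; trivial; intros T u v H.
destruct (Hm) as [m' [Hm1 Hm2]].
destruct (cartesian_lift (g := v) (t := m' ∘ fmap p u) Hk) as [w [H1 H2]].
- apply (iso_monic Hn); rw (eq_sym (fmap_square p Hc)); rw Hm2.
  apply (fmap_square p H).
- exists w; split; [split; trivial |].
  + apply (cartesian_ext Hd).
    * rewrite fmap_comp, H1; now rw Hm2.
    * rw Hc; rewrite H; now rewrite H2.
  + intros w' [H3 H4]; apply (cartesian_ext Hk).
    * rewrite H1, <- H3, fmap_comp; now rw Hm1.
    * congruence.
Qed.

End Cartesian.

(** * Fibred type-theoretic fibration categories *)

Section FibredTtfc.

Variables (E B : category) (fibE : mor_class E) (fibB : mor_class B).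
Variable p : functor E B.
Hypothesis Hp : is_fibred_ttfc fibE fibB p.

Let HE : is_ttfc fibE := fttfc_total Hp.
Let HB : is_ttfc fibB := fttfc_base Hp.

(** Condition (3) with [J] equal to [p X] itself, so that no cast remains. *)
Lemma induced_fib (Z X Y : E) (c : hom X Y) (a : hom Z X) :
  cartesian p c -> fibB (fmap p a) -> fibE (c ∘ a) -> fibE a.
Proof.
intros Hc Ha Hg.
apply (@fttfc_induced_fib _ _ _ _ _ Hp Z Y (c ∘ a) (p X) (fmap p a) (fmap p c)
         X eq_refl c a); trivial.
- apply fmap_comp.
- reflexivity.
- reflexivity.
Qed.

(** [n] is vertical only up to an isomorphism, because [D] lies over [p X] by a propositional
    equality. *)
Lemma vertical_cartesian_factorization (X Y : E) (f : hom X Y) :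
  exists (D : E) (c : hom D Y) (n : hom X D),
    cartesian p c /\ is_iso (fmap p n) /\ c ∘ n = f.
Proof.
destruct (cartesian_lift_exists (fttfc_fibred Hp) (fmap p f))
  as [D [e [c [Hc He]]]].
destruct (cartesian_lift (g := f) (t := cast_iso (eq_sym e)) Hc) as [n [H1 H2]].
- rewrite He; norm; rewrite cast_iso_symr; now norm.
- exists D, c, n; repeat split; trivial; rewrite H1; apply is_iso_cast.
Qed.

(* [q] is a vertical fibration followed by a cartesian morphism; lifting against the
   vertical part leaves no freedom for the base of the lift. *)
Lemma lift_above (X Y U V : E) (i : hom U V) (q : hom X Y) (f : hom U X)
    (g : hom V Y) (t : hom (p V) (p X)) :
  acyclic_cofibration fibE i -> fibE q -> q ∘ f = g ∘ i ->
  t ∘ fmap p i = fmap p f -> fmap p q ∘ t = fmap p g ->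
  exists h : hom V X, h ∘ i = f /\ q ∘ h = g /\ fmap p h = t.
Proof.
intros Hi Hq H Ht1 Ht2.
destruct (vertical_cartesian_factorization q) as [D [c [n [Hc [Hn Hcn]]]]].
assert (Hfn : fibE n).
{ apply (induced_fib Hc); [now apply (ttfc_fib_iso HB) | now rewrite Hcn]. }
destruct (cartesian_lift (g := g) (t := fmap p n ∘ t) Hc) as [g' [H1 H2]].
- rw (fmap_triangle p Hcn); exact Ht2.
- destruct (Hi _ _ n Hfn f g') as [h [H3 H4]].
  + apply (cartesian_ext Hc).
    * rewrite !fmap_comp, H1; norm; now rewrite Ht1.
    * rw Hcn; now rw H2.
  + exists h; repeat split; trivial.
    * rewrite <- H2, <- H4; now rw Hcn.
    * apply (iso_monic Hn); now rw (fmap_triangle p H4).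
Qed.

(** Split [g] into a vertical fibration [n] and a cartesian [c], and [n ∘ k] into a vertical [m] and
    a cartesian [d]. Then [m] is a pullback of [n] along [d], hence a fibration, and [c ∘ d] is
    cartesian above a fibration. *)
Lemma fib_reindex (M N V : E) (g : hom N V) (k : hom M N) :
  fibE g -> cartesian p k -> fibB (fmap p (g ∘ k)) -> fibE (g ∘ k).
Proof.
intros Hg Hk Hgk.
destruct (vertical_cartesian_factorization g) as [V1 [c [n [Hc [Hn Hcn]]]]].
destruct (vertical_cartesian_factorization (n ∘ k)) as [V2 [d [m [Hd [Hm Hdm]]]]].
assert (Hfn : fibE n).
{ apply (induced_fib Hc); [now apply (ttfc_fib_iso HB) | now rewrite Hcn]. }
assert (Hfm : fibE m).
{ exact (ttfc_fib_pullback HE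
    (Pullback (cartesian_square_pullback Hk Hd Hm Hn Hdm)) Hfn). }
assert (Heq : g ∘ k = (c ∘ d) ∘ m) by (rewrite <- Hcn; norm; now rewrite Hdm).
rewrite Heq; apply (ttfc_fib_comp HE); trivial.
apply (fttfc_cartesian_fib Hp); [now apply cartesian_comp |].
destruct (Hm) as [m' [Hm1 Hm2]].
replace (fmap p (c ∘ d)) with (fmap p (g ∘ k) ∘ m').
- apply (fib_comp_iso HB); trivial; now exists (fmap p m).
- rewrite Heq, fmap_comp; norm; rewrite Hm2; now norm.
Qed.

(* The middle object of an arbitrary factorization [u = r ∘ j] is moved back over
   [p X] along the acyclic cofibration [p j], a section of [p r] up to isomorphism. *)
Lemma vertical_factorization (X Y : E) (u : hom X Y) :
  is_iso (fmap p u) ->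
  exists (N : E) (e : p N = p X) (j : hom X N) (r : hom N Y),
    acyclic_cofibration fibE j /\ fibE r /\ u = r ∘ j /\
    cast_iso e ∘ fmap p j = idm (p X) /\ fmap p r = fmap p u ∘ cast_iso e.
Proof.
intros Hu.
destruct (ttfc_factorization HE u) as [M [j [r [Hj [Hr Hrj]]]]].
destruct (cartesian_lift_exists (fttfc_fibred Hp) (fmap p j))
  as [N [e [c [Hc Hpc]]]].
destruct (cartesian_lift (g := j) (t := cast_iso (eq_sym e)) Hc) as [j' [H1 H2]].
{ rewrite Hpc; norm; rewrite cast_iso_symr; now norm. }
assert (Hpr : fmap p (r ∘ c) = fmap p u ∘ cast_iso e).
{ rewrite fmap_comp, Hpc, Hrj, fmap_comp; now norm. }
assert (Hacof : acyclic_cofibration fibE c).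
{ apply (fttfc_cartesian_acof Hp Hc); rewrite Hpc; apply acof_comp.
  - now apply (tt_functor_acof (fttfc_functor Hp)).
  - apply acof_iso, is_iso_cast. }
(* A retraction of [c] exhibits [j'] as a retract of [j = c ∘ j']. *)
destruct (acof_retraction HE Hacof) as [s Hs].
exists N, e, j', (r ∘ c); repeat split.
- exact (acof_retract Hj Hs H2).
- apply (fib_reindex Hr Hc); rewrite Hpr; apply (ttfc_fib_iso HB).
  apply is_iso_comp; trivial; apply is_iso_cast.
- norm; now rewrite H2.
- rewrite H1; apply cast_iso_symr.
- exact Hpr.
Qed.

Lemma factorization_above (X Y : E) (f : hom X Y) (M : B)
    (i : hom (p X) M) (q : hom M (p Y)) :
  acyclic_cofibration fibB i -> fibB q -> fmap p f = q ∘ i ->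
  exists (N : E) (e : p N = M) (j : hom X N) (r : hom N Y),
    acyclic_cofibration fibE j /\ fibE r /\ f = r ∘ j /\
    cast_iso e ∘ fmap p j = i /\ fmap p r = q ∘ cast_iso e.
Proof.
intros Hi Hq Hf.
destruct (cartesian_lift_exists (fttfc_fibred Hp) q) as [Y' [eY [c [Hc Hpc]]]].
assert (Hfc : fibE c).
{ apply (fttfc_cartesian_fib Hp Hc); rewrite Hpc.
  apply (fib_comp_iso HB); trivial; apply is_iso_cast. }
destruct (cartesian_lift (g := f) (t := cast_iso (eq_sym eY) ∘ i) Hc)
  as [x [Hx1 Hx2]].
{ rewrite Hpc, Hf; norm; now rw (cast_iso_symr eY). }
destruct (acof_retraction HB Hi) as [rho Hrho].
destruct (cartesian_lift_exists (fttfc_fibred Hp) rho) as [X' [eX [k [Hk Hpk]]]].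
destruct (cartesian_lift (g := idm X) (t := cast_iso (eq_sym eX) ∘ i) Hk)
  as [l [Hl1 Hl2]].
{ rewrite Hpk, fmap_id; norm; now rw (cast_iso_symr eX). }
(* [l] is a section of the cartesian [k], hence cartesian by cancellation, and it lies above [i] up
   to a cast. *)
assert (Hl : acyclic_cofibration fibE l).
{ apply (fttfc_cartesian_acof Hp).
  - apply (cartesian_cancel Hk); rewrite Hl2; apply cartesian_iso, is_iso_idm.
  - rewrite Hl1; apply acof_comp; trivial.
    apply acof_iso; exact (is_iso_cast (eq_sym eX)). }
(* Extending [x] along [l] is a lifting problem against the map from [Y'] to a terminal object. As
   [p] preserves the latter, the conditions over it hold automatically, and the base of the
   extension [u] can be prescribed to be an isomorphism. *)
destruct (ttfc_terminal HE) as [T HT].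
pose proof (tt_functor_terminal (fttfc_functor Hp) HT) as HpT.
destruct (terminal_hom X' HT) as [x' _], (terminal_hom Y' HT) as [y' _].
destruct (@lift_above _ _ _ _ l y' x x' (cast_iso (eq_sym eY) ∘ cast_iso eX))
  as [u [Hu1 [_ Hu2]]]; trivial.
{ now apply (ttfc_fib_terminal HE). }
{ now apply terminal_ext. }
{ rewrite Hl1, Hx1; norm; now rw (cast_iso_symr eX). }
{ now apply terminal_ext. }
destruct (@vertical_factorization _ _ u) as [N [e [j [r [Hj [Hr [Hrj [H1 H2]]]]]]]].
{ rewrite Hu2; apply is_iso_comp; [exact (is_iso_cast (eq_sym eY)) |].
  apply is_iso_cast. }
assert (He : cast_iso (eq_trans e eX) = cast_iso eX ∘ cast_iso e).
{ destruct eX; simpl; now rewrite compose_idl. }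
exists N, (eq_trans e eX), (j ∘ l), (c ∘ r); repeat split.
- now apply acof_comp.
- now apply (ttfc_fib_comp HE).
- norm; rwl Hrj; rewrite Hu1; now symmetry.
- rewrite fmap_comp, He, Hl1; norm; rw H1; now rw (cast_iso_symr eX).
- rewrite fmap_comp, He, Hpc, H2, Hu2; norm; now rw (cast_iso_symr eY).
Qed.

End FibredTtfc.

(** * Dependent products *)

(** [bijective] asks for an inverse function, which indefinite description selects among the
    preimages. *)
Lemma bijective_of_inj_surj (X Y : Type) (f : X -> Y) :
  injective f -> (forall y, exists x, f x = y) -> bijective f.
Proof.
intros Hi Hs.
pose (g y := proj1_sig (constructive_indefinite_description _ (Hs y))).
assert (Hg : cancel g f).
{ intros y; exact (proj2_sig (constructive_indefinite_description _ (Hs y))). }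
exists g; trivial; intros x; apply Hi, Hg.
Qed.

Lemma slice_hom_ext (C : category) (X Y Z : C) (h : hom X Z) (k : hom Y Z)
    (u v : slice_hom h k) : slice_mor u = slice_mor v -> u = v.
Proof.
destruct u as [u Hu], v as [v Hv]; simpl; intros <-.
now rewrite (proof_irrelevance _ Hu Hv).
Qed.

Section DependentProducts.

Variables (C : category) (X Y Z : C) (f : hom X Y) (g : hom Y Z).

Lemma dprod_injective (P : C) (pi : hom P Z) (phi : dprod_bijection f g pi)
    (W : C) (h : hom W Z) (Q : pullback h g) : injective (dprod_fun phi Q).
Proof. apply bij_inj, dprod_bijective. Qed.

Arguments dprod_injective {P pi} phi {W h} Q [x1 x2] _ : rename.

Lemma dprod_surjective (P : C) (pi : hom P Z) (phi : dprod_bijection f g pi)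
    (W : C) (h : hom W Z) (Q : pullback h g) (v : slice_hom (pb_snd Q) f) :
  exists u, dprod_fun phi Q u = v.
Proof. destruct (dprod_bijective phi Q) as [k _ Hk]; now exists (k v). Qed.

(* The Yoneda lemma: both sides are read off at the identity of [pi]. *)
Lemma dprod_unique (P P' : C) (pi : hom P Z) (pi' : hom P' Z)
    (phi : dprod_bijection f g pi) (phi' : dprod_bijection f g pi') :
  inhabited (pullback pi g) -> inhabited (pullback pi' g) ->
  exists a : slice_hom pi pi', is_iso a /\
    forall (W : C) (h : hom W Z) (Q : pullback h g) (u : slice_hom h pi),
      dprod_fun phi Q u = dprod_fun phi' Q (slice_comp a u).
Proof.
assert (Hex : forall (P1 P2 : C) (pi1 : hom P1 Z) (pi2 : hom P2 Z)
    (phi1 : dprod_bijection f g pi1) (phi2 : dprod_bijection f g pi2),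
  inhabited (pullback pi1 g) -> exists a : slice_hom pi1 pi2,
    forall (W : C) (h : hom W Z) (Q : pullback h g) (u : slice_hom h pi1),
      dprod_fun phi1 Q u = dprod_fun phi2 Q (slice_comp a u)).
{ intros P1 P2 pi1 pi2 phi1 phi2 [Q1].
  destruct (dprod_surjective phi2 (dprod_fun phi1 Q1 (SliceHom (compose_idr pi1))))
    as [a Ha].
  exists a; intros W h Q u.
  (* [m] is the morphism [g^* u]; naturality along it reduces a general [u] to the identity of
     [pi1]. *)
  destruct (@pullback_lift _ _ _ _ pi1 g _ _ (pb_fst Q1) (pb_snd Q1)
              (u ∘ pb_fst Q) (pb_snd Q) (pb_is_pullback Q1)) as [m [H1 H2]].
  { rw (slice_comm u); apply (proj1 (pb_is_pullback Q)). }
  rewrite (dprod_natural phi2 (m := SliceHom H2) H1), Ha.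
  rewrite <- (dprod_natural phi1 (m := SliceHom H2) H1).
  f_equal; apply slice_hom_ext; simpl; now norm. }
intros HQ HQ'.
destruct (Hex _ _ _ _ phi phi' HQ) as [a Ha].
destruct (Hex _ _ _ _ phi' phi HQ') as [b Hb].
exists a; split; trivial; exists b; split.
- destruct HQ as [Q].
  assert (H : slice_comp b a = SliceHom (compose_idr pi)).
  { apply (dprod_injective phi Q); rewrite <- Hb, Ha.
    f_equal; apply slice_hom_ext; simpl; now norm. }
  exact (f_equal (@slice_mor _ _ _ _ _ _) H).
- destruct HQ' as [Q].
  assert (H : slice_comp a b = SliceHom (compose_idr pi')).
  { apply (dprod_injective phi' Q); rewrite <- Ha, Hb.
    f_equal; apply slice_hom_ext; simpl; now norm. }
  exact (f_equal (@slice_mor _ _ _ _ _ _) H).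
Qed.

(** Composition with the isomorphism [a] is a natural bijection between slice morphisms into [pi]
    and into [pi']; it is followed by [phi']. *)
Lemma dprod_transport (P P' : C) (pi : hom P Z) (pi' : hom P' Z)
    (phi' : dprod_bijection f g pi') (a : slice_hom pi pi') :
  is_iso a -> exists phi : dprod_bijection f g pi,
    forall (W : C) (h : hom W Z) (Q : pullback h g) (u : slice_hom h pi),
      dprod_fun phi Q u = dprod_fun phi' Q (slice_comp a u).
Proof.
intros Ha.
unshelve eexists (@DprodBijection _ _ _ _ _ f g pi
  (fun W h Q u => dprod_fun phi' Q (slice_comp a u)) _ _); [| | reflexivity].
- intros W h Q; apply bijective_of_inj_surj.
  + intros u v H; apply dprod_injective in H; apply slice_hom_ext.
    apply (iso_monic Ha); exact (f_equal (@slice_mor _ _ _ _ _ _) H).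
  + intros v; destruct (dprod_surjective phi' v) as [u Hu].
    destruct Ha as [b [Hb1 Hb2]].
    assert (H : pi ∘ (b ∘ u) = h).
    { rewrite <- (slice_comm a); norm; rw Hb2; apply (slice_comm u). }
    exists (SliceHom H); rewrite <- Hu; f_equal; apply slice_hom_ext; simpl.
    now rw Hb2.
- intros W W' h h' Q Q' k m H u; simpl; rewrite <- (dprod_natural phi' H); f_equal.
  apply slice_hom_ext; simpl; now norm.
Qed.

End DependentProducts.

Arguments dprod_injective {C X Y Z f g P pi} phi {W h} Q [x1 x2] _ : rename.

(** * Change of base *)

Section ChangeOfBaseCategory.

Variables (E B A : category) (p : functor E B) (F : functor A B).

Local Notation G := (change_of_base p F).
Local Notation proj := (change_of_base_proj p F).
Local Notation base f := (@cob_base_mor E B A p F _ _ f).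
Local Notation total f := (@cob_total_mor E B A p F _ _ f).

Definition cob_iso (X : G) : hom (p (cob_total X)) (F (cob_base X)) :=
  cast_iso (cob_eq X).

Definition cob_iso_inv (X : G) : hom (F (cob_base X)) (p (cob_total X)) :=
  cast_iso (eq_sym (cob_eq X)).

Lemma cob_isoK (X : G) : cob_iso_inv X ∘ cob_iso X = idm _.
Proof. apply cast_iso_syml. Qed.

Lemma cob_iso_invK (X : G) : cob_iso X ∘ cob_iso_inv X = idm _.
Proof. apply cast_iso_symr. Qed.

Lemma is_iso_cob_iso (X : G) : is_iso (cob_iso X).
Proof. apply is_iso_cast. Qed.

Lemma is_iso_cob_iso_inv (X : G) : is_iso (cob_iso_inv X).
Proof. exact (is_iso_cast (eq_sym (cob_eq X))). Qed.

Lemma cob_square (X Y : G) (f : hom X Y) :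
  cob_iso Y ∘ fmap p (total f) = fmap F (base f) ∘ cob_iso X.
Proof. exact (proj1 (above_iff _ _ _ _) (cob_above f)). Qed.

Lemma cob_square_inv (X Y : G) (f : hom X Y) :
  cob_iso_inv Y ∘ fmap F (base f) = fmap p (total f) ∘ cob_iso_inv X.
Proof.
apply (iso_monic (is_iso_cob_iso Y)); rw (cob_iso_invK Y); rw (cob_square f).
rewrite cob_iso_invK; now norm.
Qed.

Definition cob_hom_mk (X Y : G) (s : hom (cob_base X) (cob_base Y))
    (f : hom (cob_total X) (cob_total Y))
    (H : cob_iso Y ∘ fmap p f = fmap F s ∘ cob_iso X) : @hom G X Y :=
  CobHom (proj2 (above_iff _ _ _ _) H).

Arguments cob_hom_mk X Y {s f} H.

(** Supplies the base condition when [cartesian_ext] is applied to total components. *)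
Lemma cob_fmap_total (X Y : G) (f g : hom X Y) :
  base f = base g -> fmap p (total f) = fmap p (total g).
Proof.
intros H; apply (iso_monic (is_iso_cob_iso Y)); now rewrite !cob_square, H.
Qed.

Lemma base_eq (X Y : G) (f g : hom X Y) : f = g -> base f = base g.
Proof. now intros ->. Qed.

Lemma total_eq (X Y : G) (f g : hom X Y) : f = g -> total f = total g.
Proof. now intros ->. Qed.

Lemma is_iso_base (X Y : G) (f : hom X Y) : is_iso f -> is_iso (base f).
Proof.
intros [g [H1 H2]]; exists (base g); split;
  [exact (base_eq H1) | exact (base_eq H2)].
Qed.

Lemma is_iso_total (X Y : G) (f : hom X Y) : is_iso f -> is_iso (total f).
Proof.
intros [g [H1 H2]]; exists (total g); split;
  [exact (total_eq H1) | exact (total_eq H2)].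
Qed.

(** A factorization [t] in [A] prescribes what the lift in [E] lies above: [fmap F t] conjugated by
    the structural isomorphisms. *)
Lemma cob_cartesian (X Y : G) (f : hom X Y) :
  cartesian p (total f) -> cartesian proj f.
Proof.
intros Hf; apply cartesian_intro.
- intros Z g t H; change (base f ∘ t = base g) in H.
  destruct (cartesian_lift (g := total g)
              (t := cob_iso_inv X ∘ fmap F t ∘ cob_iso Z) Hf) as [h [H1 H2]].
  { apply (iso_monic (is_iso_cob_iso Y)); rewrite cob_square.
    rw (cob_square f); rw (cob_iso_invK X); now rw (fmap_triangle F H). }
  assert (Hh : cob_iso X ∘ fmap p h = fmap F t ∘ cob_iso Z).
  { rewrite H1; norm; now rw (cob_iso_invK X). }
  exists (cob_hom_mk Z X Hh); split; trivial.
  now apply cob_hom_eq.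
- intros Z h h' H1 H2; apply cob_hom_eq; trivial.
  apply (cartesian_ext Hf); [now apply cob_fmap_total | exact (total_eq H2)].
Qed.

Hypothesis Hp : is_fibred_category p.

Lemma cob_lift (Y : G) (I : A) (s : hom I (cob_base Y)) :
  exists (X : E) (eX : p X = F I) (f : @hom G (CobOb eX) Y),
    cartesian p (total f) /\ base f = s.
Proof.
destruct (cartesian_lift_exists Hp (cob_iso_inv Y ∘ fmap F s)) as [X [e [f [Hf He]]]].
assert (H : cob_iso Y ∘ fmap p f = fmap F s ∘ cob_iso (CobOb e)).
{ rewrite He; norm; now rw (cob_iso_invK Y). }
now exists X, e, (cob_hom_mk (CobOb e) Y H).
Qed.

Lemma cob_fibred : is_fibred_category proj.
Proof.
intros Y I s; destruct (cob_lift (Y := Y) s) as [X [e [f [Hf Hs]]]].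
exists (CobOb e), eq_refl, f; split; trivial; now apply cob_cartesian.
Qed.

(** The lift [f'] of the base of [f] is cartesian in both senses, and [f] differs from it by an
    isomorphism of [F^*E], whose total component is an isomorphism of [E]. *)
Lemma cob_cartesian_total (X Y : G) (f : hom X Y) :
  cartesian proj f -> cartesian p (total f).
Proof.
intros Hf; destruct (cob_lift (base f)) as [X' [e [f' [Hf' Hs]]]].
pose proof (cob_cartesian Hf') as Hcf'.
destruct (cartesian_lift (p := proj) (f := f') (g := f) (t := idm (cob_base X)) Hcf')
  as [k [H1 H2]].
{ change (base f' ∘ idm (cob_base X) = base f); now rewrite compose_idr. }
destruct (cartesian_lift (p := proj) (f := f) (g := f') (t := idm (cob_base X)) Hf)
  as [k' [H1' H2']].
{ change (base f ∘ idm (cob_base X) = base f'); now rewrite compose_idr. }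
assert (Hk : is_iso k).
{ exists k'; split.
  - apply (cartesian_ext Hf).
    + rewrite fmap_comp, H1, H1'; apply compose_idl.
    + norm; now rw H2'.
  - apply (cartesian_ext Hcf').
    + rewrite fmap_comp, H1, H1'; apply compose_idl.
    + norm; now rw H2. }
rewrite <- (total_eq H2).
exact (cartesian_comp Hf' (cartesian_iso (is_iso_total Hk))).
Qed.

End ChangeOfBaseCategory.

Arguments cob_hom_mk {E B A p F} X Y {s f} H.

(** * Levelwise fibrations and the terminal object of [F^*E] *)

Section ChangeOfBaseTtfc.

Variables (E B A : category).
Variables (fibE : mor_class E) (fibB : mor_class B) (fibA : mor_class A).
Variables (p : functor E B) (F : functor A B).
Hypothesis Hp : is_fibred_ttfc fibE fibB p.
Hypothesis HA : is_ttfc fibA.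
Hypothesis HFfib : preserves_fibrations fibA fibB F.
Hypothesis HFpb : preserves_pullbacks_of_fibrations fibA F.
Hypothesis HFacof : preserves_acyclic_cofibrations fibA fibB F.

Local Notation G := (change_of_base p F).
Local Notation proj := (change_of_base_proj p F).
Local Notation base f := (@cob_base_mor E B A p F _ _ f).
Local Notation total f := (@cob_total_mor E B A p F _ _ f).
Local Notation fibG := (levelwise p F fibA fibE).

Let HE : is_ttfc fibE := fttfc_total Hp.
Let HB : is_ttfc fibB := fttfc_base Hp.

Lemma cob_fib_total (X Y : G) (f : hom X Y) :
  fibA (base f) -> fibB (fmap p (total f)).
Proof.
intros Hf; apply (fib_square_iso HB (is_iso_cob_iso X) (is_iso_cob_iso Y)
                    (cob_square f)).
now apply HFfib.
Qed.

Lemma cob_acof_total (X Y : G) (f : hom X Y) :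
  acyclic_cofibration fibA (base f) ->
  acyclic_cofibration fibB (fmap p (total f)).
Proof.
intros Hf; apply (acof_square_iso (is_iso_cob_iso X) (is_iso_cob_iso Y)
                    (cob_square f)).
now apply HFacof.
Qed.

(** The last two claims concern this particular [T]; isomorphisms between terminal objects then
    carry them to all others. *)
Lemma cob_terminal_exists :
  exists T : G, is_terminal T /\ is_terminal (cob_base T) /\
    forall (X : G) (f : hom X T), fibG _ _ f.
Proof.
destruct (ttfc_terminal HE) as [S HS], (ttfc_terminal HA) as [T HT].
pose proof (tt_functor_terminal (fttfc_functor Hp) HS) as HpS.
destruct (terminal_hom (F T) HpS) as [t _].
destruct (cartesian_lift_exists (fttfc_fibred Hp) t) as [T' [e [c [Hc _]]]].
exists (CobOb e); split; [| split; trivial].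
- intros X; destruct (terminal_hom (cob_base X) HT) as [s _].
  destruct (terminal_hom (cob_total X) HS) as [x _].
  destruct (cartesian_lift (g := x)
    (t := cob_iso_inv (CobOb e) ∘ fmap F s ∘ cob_iso X) Hc) as [f [H1 H2]].
  { now apply terminal_ext. }
  assert (Hf : cob_iso (CobOb e) ∘ fmap p f = fmap F s ∘ cob_iso X).
  { rewrite H1; norm; now rw (cob_iso_invK (CobOb e)). }
  exists (cob_hom_mk X (CobOb e) Hf); split; trivial; intros f' _.
  assert (Hs : s = base f') by now apply terminal_ext.
  apply cob_hom_eq; trivial; apply (cartesian_ext Hc).
  + now apply (cob_fmap_total (f := cob_hom_mk X (CobOb e) Hf)).
  + now apply terminal_ext.
- intros X f.
  assert (Hf : fibA (base f)) by now apply (ttfc_fib_terminal HA).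
  split; trivial.
  (* The total object need not be terminal in [E]; condition (3) along [c] reduces the claim to the
     map into the terminal object [S]. *)
  apply (induced_fib Hp Hc); [exact (cob_fib_total Hf) |].
  now apply (ttfc_fib_terminal HE).
Qed.

Lemma cob_fib_comp (X Y Z : G) (g : hom Y Z) (f : hom X Y) :
  fibG _ _ g -> fibG _ _ f -> fibG _ _ (g ∘ f).
Proof.
intros [Hg1 Hg2] [Hf1 Hf2]; split;
  [now apply (ttfc_fib_comp HA) | now apply (ttfc_fib_comp HE)].
Qed.

Lemma cob_fib_iso (X Y : G) (f : hom X Y) : is_iso f -> fibG _ _ f.
Proof.
intros Hf; split.
- now apply (ttfc_fib_iso HA), is_iso_base.
- now apply (ttfc_fib_iso HE), is_iso_total.
Qed.

Lemma cob_terminal_base (T : G) : is_terminal T -> is_terminal (cob_base T).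
Proof.
intros HT; destruct cob_terminal_exists as [T' [HT' [Hb _]]].
destruct (terminal_iso HT' HT) as [k Hk].
exact (iso_terminal (is_iso_base Hk) Hb).
Qed.

Lemma cob_fib_terminal (X T : G) (f : hom X T) : is_terminal T -> fibG _ _ f.
Proof.
intros HT; destruct cob_terminal_exists as [T' [HT' [_ Hfib]]].
destruct (terminal_iso HT' HT) as [k Hk], (terminal_hom X HT') as [x _].
rewrite (terminal_ext f (k ∘ x) HT).
apply cob_fib_comp; [now apply cob_fib_iso | apply Hfib].
Qed.

(** * Pullbacks in [F^*E] *)

(** The mediating morphisms [w] and [w'] are found independently. They form a morphism of [F^*E]
    because [F] preserves the pullback in [A], so that the required square can be checked on its two
    projections. *)
Lemma cob_pullback_intro (X Y Z P : G) (f : hom X Z) (g : hom Y Z)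
    (p1 : hom P X) (p2 : hom P Y) :
  fibA (base g) ->
  is_pullback (base f) (base g) (base p1) (base p2) ->
  is_pullback (total f) (total g) (total p1) (total p2) ->
  is_pullback f g p1 p2.
Proof.
intros Hg HbP HtP; split.
- apply cob_hom_eq; [apply (proj1 HbP) | apply (proj1 HtP)].
- intros W u v H.
  destruct (pullback_lift HbP (base_eq H)) as [w [H1 H2]].
  destruct (pullback_lift HtP (total_eq H)) as [w' [H1' H2']].
  assert (Hw : cob_iso P ∘ fmap p w' = fmap F w ∘ cob_iso W).
  { apply (pullback_ext (HFpb Hg HbP)).
    - rwl (cob_square p1); rw (fmap_triangle p H1'); rw (fmap_triangle F H1).
      apply cob_square.
    - rwl (cob_square p2); rw (fmap_triangle p H2'); rw (fmap_triangle F H2).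
      apply cob_square. }
  exists (cob_hom_mk W P Hw); split.
  + split; now apply cob_hom_eq.
  + intros k [Hk1 Hk2]; apply cob_hom_eq; simpl.
    * apply (pullback_ext HbP).
      -- rewrite H1; symmetry; exact (base_eq Hk1).
      -- rewrite H2; symmetry; exact (base_eq Hk2).
    * apply (pullback_ext HtP).
      -- rewrite H1'; symmetry; exact (total_eq Hk1).
      -- rewrite H2'; symmetry; exact (total_eq Hk2).
Qed.

(** [F P] and [p Q] are pullbacks of isomorphic cospans in [B]; reindexing [Q] along the comparison
    isomorphism puts it over [F P]. *)
Lemma cob_pullback_exists (X Y Z : G) (f : hom X Z) (g : hom Y Z) :
  fibG _ _ g -> exists (P : G) (p1 : hom P X) (p2 : hom P Y),
    is_pullback (base f) (base g) (base p1) (base p2) /\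
    is_pullback (total f) (total g) (total p1) (total p2).
Proof.
intros [Hbg Htg].
destruct (ttfc_pullback HA (base f) Hbg) as [[P p1 p2 HP]].
destruct (ttfc_pullback HE (total f) Htg) as [[Q q1 q2 HQ]].
pose proof (tt_functor_pullback (fttfc_functor Hp) Htg HQ) as HpQ.
pose proof (pullback_cospan_iso (is_iso_cob_iso_inv X) (is_iso_cob_iso_inv Y)
  (is_iso_cob_iso_inv Z) (cob_square_inv f) (cob_square_inv g) (HFpb Hbg HP))
  as HFP.
destruct (pullback_unique HFP HpQ) as [k [Hk [H1 H2]]].
destruct (cartesian_lift_exists (fttfc_fibred Hp) k) as [Q' [e [c [Hc Hck]]]].
assert (Hci : is_iso c).
{ apply (cartesian_above_iso Hc); rewrite Hck.
  apply is_iso_comp; trivial; apply is_iso_cast. }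
assert (Hq1 : cob_iso X ∘ fmap p (q1 ∘ c) = fmap F p1 ∘ cob_iso (CobOb e)).
{ rewrite fmap_comp, Hck; rw H1; now rw (cob_iso_invK X). }
assert (Hq2 : cob_iso Y ∘ fmap p (q2 ∘ c) = fmap F p2 ∘ cob_iso (CobOb e)).
{ rewrite fmap_comp, Hck; rw H2; now rw (cob_iso_invK Y). }
exists (CobOb e), (cob_hom_mk (CobOb e) X Hq1), (cob_hom_mk (CobOb e) Y Hq2).
split; trivial.
now apply pullback_iso.
Qed.

(** Any pullback is isomorphic to the levelwise one constructed above. *)
Lemma cob_pullback_elim (X Y Z P : G) (f : hom X Z) (g : hom Y Z)
    (p1 : hom P X) (p2 : hom P Y) :
  fibG _ _ g -> is_pullback f g p1 p2 ->
  is_pullback (base f) (base g) (base p1) (base p2) /\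
  is_pullback (total f) (total g) (total p1) (total p2).
Proof.
intros Hg HP; destruct (cob_pullback_exists f Hg) as [P' [q1 [q2 [Hb Ht]]]].
pose proof (cob_pullback_intro (proj1 Hg) Hb Ht) as HP'.
destruct (pullback_unique HP HP') as [k [Hk [<- <-]]].
split; [exact (pullback_iso Hb (is_iso_base Hk)) |
        exact (pullback_iso Ht (is_iso_total Hk))].
Qed.

(** * Acyclic cofibrations and factorizations in [F^*E] *)

(** The lift is found first in [A]; [lift_above] then yields a lift in [E] above its image. *)
Lemma cob_acof (X Y : G) (i : hom X Y) :
  acyclic_cofibration fibA (base i) -> acyclic_cofibration fibE (total i) ->
  acyclic_cofibration fibG i.
Proof.
intros Hb Ht V W q [Hqb Hqt] f g H.
destruct (Hb _ _ _ Hqb (base f) (base g) (base_eq H)) as [h [H1 H2]].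
destruct (@lift_above _ _ _ _ _ Hp _ _ _ _ (total i) (total q) (total f) (total g)
  (cob_iso_inv V ∘ fmap F h ∘ cob_iso Y)) as [h' [H1' [H2' H3']]]; trivial.
- exact (total_eq H).
- norm; rw (cob_square i); rw (fmap_triangle F H1); rwl (cob_square f).
  now rw (cob_isoK V).
- norm; rwl (cob_square_inv q); rw (fmap_triangle F H2); rwl (cob_square g).
  now rw (cob_isoK W).
- assert (Hh : cob_iso V ∘ fmap p h' = fmap F h ∘ cob_iso Y).
  { rewrite H3'; norm; now rw (cob_iso_invK V). }
  exists (cob_hom_mk Y V Hh); split; now apply cob_hom_eq.
Qed.

(** The acyclic cofibration is stated componentwise, which is what the retract argument for
    [cob_acof_base] needs. *)
Lemma cob_factorization (X Y : G) (f : hom X Y) :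
  exists (M : G) (i : hom X M) (q : hom M Y),
    acyclic_cofibration fibA (base i) /\ acyclic_cofibration fibE (total i) /\
    fibG _ _ q /\ f = q ∘ i.
Proof.
destruct (ttfc_factorization HA (base f)) as [M [i [q [Hi [Hq Hf]]]]].
destruct (@factorization_above _ _ _ _ _ Hp _ _ (total f) (F M)
  (fmap F i ∘ cob_iso X) (cob_iso_inv Y ∘ fmap F q))
  as [N [e [j [r [Hj [Hr [Hrj [H1 H2]]]]]]]].
- apply acof_comp; [now apply HFacof | apply acof_iso, is_iso_cob_iso].
- apply (fib_iso_comp HB); [apply is_iso_cob_iso_inv | now apply HFfib].
- norm; rw (fmap_triangle F (eq_sym Hf)); rwl (cob_square f); now rw (cob_isoK Y).
- assert (Hr' : cob_iso Y ∘ fmap p r = fmap F q ∘ cob_iso (CobOb e)).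
  { rewrite H2; norm; now rw (cob_iso_invK Y). }
  exists (CobOb e), (cob_hom_mk X (CobOb e) H1), (cob_hom_mk (CobOb e) Y Hr').
  repeat split; trivial; now apply cob_hom_eq.
Qed.

(** Retract argument: lifting [i] against the fibration of its own factorization makes the base of
    [i] a retract of the base of [j]. *)
Lemma cob_acof_base (X Y : G) (i : hom X Y) :
  acyclic_cofibration fibG i -> acyclic_cofibration fibA (base i).
Proof.
intros Hi; destruct (cob_factorization i) as [M [j [q [Hb [_ [Hq H]]]]]].
destruct (Hi _ _ q Hq j (idm Y)) as [s [H1 H2]].
- now rewrite compose_idl.
- exact (acof_retract Hb (base_eq H2) (base_eq H1)).
Qed.

(* The comparison [c : F P -> p R] from the product in [A] to the image of the one in
   [E] is the transpose of [F ev]; the product in [F^*E] is [c^*R] above [P]. *)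
Section DependentProduct.

Variables (X Y Z : G) (f : hom X Y) (g : hom Y Z).
Hypotheses (Hg : fibG _ _ g).

Variables (P : A) (piA : hom P (cob_base Z)).
Variable phiA : dprod_bijection (base f) (base g) piA.
Variables (R : E) (piE : hom R (cob_total Z)).
Variable phiE : dprod_bijection (total f) (total g) piE.
Variable phiB : dprod_bijection (fmap p (total f)) (fmap p (total g)) (fmap p piE).
Hypothesis HphiB : forall (W : E) (h : hom W (cob_total Z)) (Q : pullback h (total g))
    (HQ : is_pullback (fmap p h) (fmap p (total g))
            (fmap p (pb_fst Q)) (fmap p (pb_snd Q)))
    (u : slice_hom h piE),
  dprod_fun phiB (Pullback HQ) (slice_map p u) = slice_map p (dprod_fun phiE Q u).

Variable D : pullback piA (base g).
(** The evaluation morphism, i.e. the counit at [f]. *)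
Let ev := dprod_fun phiA D (SliceHom (compose_idr piA)).

(** The second clause says that applying [F] and composing with [c] before transposing in [B]
    amounts to transposing in [A] and then applying [F], up to the structural isomorphisms. *)
Definition comparison_spec (c : hom (F P) (p R)) : Prop :=
  fmap p piE ∘ c = cob_iso_inv Z ∘ fmap F piA /\
  forall (W : G) (h : hom W Z) (Q : G) (q1 : hom Q W) (q2 : hom Q Y)
    (HA : is_pullback (base h) (base g) (base q1) (base q2))
    (HB : is_pullback (fmap p (total h)) (fmap p (total g))
            (fmap p (total q1)) (fmap p (total q2)))
    (u0 : slice_hom (base h) piA)
    (u1 : slice_hom (fmap p (total h)) (fmap p piE)),
    slice_mor u1 = c ∘ fmap F u0 ∘ cob_iso W ->
    cob_iso X ∘ dprod_fun phiB (Pullback HB) u1 =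
    fmap F (dprod_fun phiA (Pullback HA) u0) ∘ cob_iso Q.

(** As [F] preserves the pullback [D], the image of [ev] can be transposed back along [phiB], which
    gives [c]. The second clause extends from [ev] to every [u0] by naturality of both
    bijections. *)
Lemma comparison_exists : exists c, comparison_spec c.
Proof.
pose proof (pullback_cospan_iso (is_iso_idm _) (is_iso_cob_iso_inv Y)
  (is_iso_cob_iso_inv Z) (eq_sym (compose_idr (cob_iso_inv Z ∘ fmap F piA)))
  (cob_square_inv g) (HFpb (proj1 Hg) (pb_is_pullback D))) as HD.
assert (Hev : fmap p (total f) ∘ (cob_iso_inv X ∘ fmap F ev) =
              cob_iso_inv Y ∘ fmap F (pb_snd D)).
{ rwl (cob_square_inv f); now rw (fmap_triangle F (slice_comm ev)). }
destruct (dprod_surjective phiB (Q := Pullback HD) (SliceHom Hev)) as [c Hc].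
exists c; split; [apply (slice_comm c) |].
intros W h Q q1 q2 HQA HQB u0 u1 Hu.
(* [m0] is the pullback of [u0] along [g], so the transpose of [u0] is [ev ∘ m0]; its image under
   [F] plays the same role for [u1] in [B]. *)
destruct (pullback_lift (u := u0 ∘ base q1) (v := base q2) (pb_is_pullback D))
  as [m0 [Hm1 Hm2]].
{ rw (slice_comm u0); apply (proj1 HQA). }
assert (H0 : dprod_fun phiA (Pullback HQA) u0 =
             slice_comp ev (SliceHom (Hm2 : _ = pb_snd (Pullback HQA)))).
{ unfold ev; rewrite <- (dprod_natural phiA (Q' := Pullback HQA) (k := u0)); trivial.
  f_equal; apply slice_hom_ext; simpl; now norm. }
assert (Hk : (cob_iso_inv Z ∘ fmap F piA) ∘ (fmap F u0 ∘ cob_iso W) =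
             fmap p (total h)).
{ norm; rw (fmap_triangle F (slice_comm u0)); rwl (cob_square h).
  now rw (cob_isoK Z). }
assert (Hm : (cob_iso_inv Y ∘ fmap F (pb_snd D)) ∘ (fmap F m0 ∘ cob_iso Q) =
             fmap p (total q2)).
{ norm; rw (fmap_triangle F Hm2); rwl (cob_square q2); now rw (cob_isoK Y). }
assert (H1 : dprod_fun phiB (Pullback HQB) u1 =
  slice_comp (SliceHom Hev) (SliceHom (Hm : _ = pb_snd (Pullback HQB)))).
{ rewrite <- Hc.
  transitivity (dprod_fun phiB (Pullback HQB) (slice_comp c (SliceHom Hk))).
  - f_equal; apply slice_hom_ext; simpl; rewrite Hu; now norm.
  - apply (dprod_natural phiB (Q := Pullback HD) (Q' := Pullback HQB)
      (k := SliceHom Hk) (m := SliceHom (Hm : _ = pb_snd (Pullback HQB)))).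
    simpl; norm; rw (fmap_triangle F Hm1); rewrite fmap_comp; norm.
    now rw (cob_square q1). }
rewrite H0, H1; simpl; rewrite fmap_comp; norm; now rw (cob_iso_invK X).
Qed.

Variable c : hom (F P) (p R).
Hypothesis Hc : comparison_spec c.
Variables (N : E) (e : p N = F P) (k : hom N R).
Hypotheses (Hk : cartesian p k) (Hkc : fmap p k = c ∘ cast_iso e).

Lemma cob_dprod_pi_above :
  cob_iso Z ∘ fmap p (piE ∘ k) = fmap F piA ∘ cob_iso (CobOb e).
Proof.
rewrite fmap_comp, Hkc; rw (proj1 Hc); now rw (cob_iso_invK Z).
Qed.

Definition cob_dprod_pi : @hom G (CobOb e) Z :=
  cob_hom_mk (CobOb e) Z cob_dprod_pi_above.

Section Transpose.

Variables (W : G) (h : hom W Z) (Q : pullback h g).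

Definition pullback_base : pullback (base h) (base g) :=
  Pullback (proj1 (cob_pullback_elim Hg (pb_is_pullback Q))).

Definition pullback_total : pullback (total h) (total g) :=
  Pullback (proj2 (cob_pullback_elim Hg (pb_is_pullback Q))).

Lemma pullback_total_fmap :
  is_pullback (fmap p (total h)) (fmap p (total g))
    (fmap p (total (pb_fst Q))) (fmap p (total (pb_snd Q))).
Proof.
exact (tt_functor_pullback (fttfc_functor Hp) (proj2 Hg)
         (proj2 (cob_pullback_elim Hg (pb_is_pullback Q)))).
Qed.

Definition slice_base (u : slice_hom h cob_dprod_pi) : slice_hom (base h) piA :=
  @SliceHom _ _ _ _ (base h) piA (base (slice_mor u)) (base_eq (slice_comm u)).

Lemma slice_total_comm (u : slice_hom h cob_dprod_pi) :
  piE ∘ (k ∘ total (slice_mor u)) = total h.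
Proof. rewrite compose_assoc; exact (total_eq (slice_comm u)). Qed.

Definition slice_total (u : slice_hom h cob_dprod_pi) : slice_hom (total h) piE :=
  SliceHom (slice_total_comm u).

(** [HphiB] turns the image under [p] of the transpose in [E] into a transpose in [B], which the
    specification of [c] compares with the transpose in [A]. Hence the two transposes form a
    morphism of [F^*E]. *)
Lemma cob_dprod_above (u0 : slice_hom (base h) piA) (u1 : slice_hom (total h) piE) :
  fmap p u1 = c ∘ fmap F u0 ∘ cob_iso W ->
  cob_iso X ∘ fmap p (dprod_fun phiE pullback_total u1) =
  fmap F (dprod_fun phiA pullback_base u0) ∘ cob_iso (pb_ob Q).
Proof.
intros Hu; unfold pullback_base.
rewrite <- (proj2 Hc _ _ _ _ _ _ pullback_total_fmap u0 (slice_map p u1) Hu).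
f_equal; rewrite (HphiB (Q := pullback_total) pullback_total_fmap); reflexivity.
Qed.

Lemma slice_total_above (u : slice_hom h cob_dprod_pi) :
  fmap p (slice_total u) = c ∘ fmap F (slice_base u) ∘ cob_iso W.
Proof.
simpl; rewrite fmap_comp, Hkc; norm; f_equal; exact (cob_square u).
Qed.

Definition cob_dprod_mor (u : slice_hom h cob_dprod_pi) : hom (pb_ob Q) X :=
  cob_hom_mk (pb_ob Q) X (cob_dprod_above (slice_total_above u)).

Lemma cob_dprod_comm (u : slice_hom h cob_dprod_pi) :
  f ∘ cob_dprod_mor u = pb_snd Q.
Proof.
apply cob_hom_eq.
- exact (slice_comm (dprod_fun phiA pullback_base (slice_base u))).
- exact (slice_comm (dprod_fun phiE pullback_total (slice_total u))).
Qed.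

Definition cob_dprod_fun (u : slice_hom h cob_dprod_pi) : slice_hom (pb_snd Q) f :=
  SliceHom (cob_dprod_comm u).

(** [phiA] determines the base and [phiE] the composite of the total component with [k]; since [k]
    is cartesian, both together determine the total component. *)
Lemma cob_dprod_fun_inj : injective cob_dprod_fun.
Proof.
intros u v H; apply (f_equal (@slice_mor _ _ _ _ _ _)) in H.
assert (Hb : base (slice_mor u) = base (slice_mor v)).
{ assert (H' : slice_base u = slice_base v).
  { apply (dprod_injective phiA pullback_base), slice_hom_ext; exact (base_eq H). }
  exact (f_equal (@slice_mor _ _ _ _ _ _) H'). }
apply slice_hom_ext, cob_hom_eq; trivial.
apply (cartesian_ext Hk); [exact (cob_fmap_total Hb) |].
assert (H' : slice_total u = slice_total v).
{ apply (dprod_injective phiE pullback_total), slice_hom_ext; exact (total_eq H). }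
exact (f_equal (@slice_mor _ _ _ _ _ _) H').
Qed.

Lemma cob_dprod_fun_surj (v : slice_hom (pb_snd Q) f) :
  exists u, cob_dprod_fun u = v.
Proof.
pose (v0 := @SliceHom _ _ _ _ (pb_snd pullback_base) (base f) (base (slice_mor v))
              (base_eq (slice_comm v))).
pose (v1 := @SliceHom _ _ _ _ (pb_snd pullback_total) (total f) (total (slice_mor v))
              (total_eq (slice_comm v))).
destruct (dprod_surjective phiA v0) as [u0 Hu0].
destruct (dprod_surjective phiE v1) as [u1 Hu1].
assert (Hcu : fmap p piE ∘ (c ∘ fmap F u0 ∘ cob_iso W) = fmap p (total h)).
{ norm; rw (proj1 Hc); rw (fmap_triangle F (slice_comm u0)); rwl (cob_square h).
  now rw (cob_isoK Z). }
(* [u0] and [u1] were chosen independently. Injectivity of [phiB] reduces their compatibility to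
   that of their transposes, which are the two components of [v]. *)
assert (Hu : fmap p u1 = c ∘ fmap F u0 ∘ cob_iso W).
{ assert (H : slice_map p u1 = SliceHom Hcu).
  { apply (dprod_injective phiB (Pullback pullback_total_fmap)).
    rewrite (HphiB (Q := pullback_total) pullback_total_fmap), Hu1.
    apply slice_hom_ext, (iso_monic (is_iso_cob_iso X)).
    rewrite (proj2 Hc _ _ _ _ _
      (proj1 (cob_pullback_elim Hg (pb_is_pullback Q)))
      pullback_total_fmap u0 (SliceHom Hcu) eq_refl).
    change (cob_iso X ∘ fmap p (total (slice_mor v)) =
            fmap F (dprod_fun phiA pullback_base u0) ∘ cob_iso (pb_ob Q)).
    rewrite Hu0; apply cob_square. }
  exact (f_equal (@slice_mor _ _ _ _ _ _) H). }
(* Compatibility is what allows [u1] to be lifted through [k] above the image of [u0]. *)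
destruct (cartesian_lift (X := N) (g := u1 : hom _ _)
  (t := cob_iso_inv (CobOb e) ∘ fmap F u0 ∘ cob_iso W) Hk) as [w [Hw1 Hw2]].
{ rewrite Hu, Hkc; norm; now rw (cob_iso_invK (CobOb e)). }
assert (Hw : cob_iso (CobOb e) ∘ fmap p w = fmap F u0 ∘ cob_iso W).
{ rewrite Hw1; norm; now rw (cob_iso_invK (CobOb e)). }
assert (Hpi : cob_dprod_pi ∘ cob_hom_mk W (CobOb e) Hw = h).
{ apply cob_hom_eq; simpl; [apply (slice_comm u0) |].
  norm; rewrite Hw2; apply (slice_comm u1). }
exists (SliceHom Hpi); apply slice_hom_ext, cob_hom_eq.
- replace (base (slice_mor v)) with (slice_mor v0) by reflexivity; rewrite <- Hu0.
  simpl; do 2 f_equal; now apply slice_hom_ext.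
- replace (total (slice_mor v)) with (slice_mor v1) by reflexivity; rewrite <- Hu1.
  simpl; do 2 f_equal; now apply slice_hom_ext.
Qed.

End Transpose.

Lemma cob_dprod_natural (W W' : G) (h : hom W Z) (h' : hom W' Z)
    (Q : pullback h g) (Q' : pullback h' g)
    (l : slice_hom h' h) (m : slice_hom (pb_snd Q') (pb_snd Q)) :
  pb_fst Q ∘ m = l ∘ pb_fst Q' ->
  forall u : slice_hom h cob_dprod_pi,
    cob_dprod_fun Q' (slice_comp u l) = slice_comp (cob_dprod_fun Q u) m.
Proof.
intros H u; apply slice_hom_ext, cob_hom_eq.
- pose proof (@dprod_natural _ _ _ _ _ _ _ _ phiA _ _ _ _
    (pullback_base Q) (pullback_base Q')
    (@SliceHom _ _ _ _ (base h') (base h) (base (slice_mor l)) (base_eq (slice_comm l)))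
    (@SliceHom _ _ _ _ (base (pb_snd Q')) (base (pb_snd Q)) (base (slice_mor m))
       (base_eq (slice_comm m)))
    (base_eq H) (slice_base u)) as Hn.
  apply (f_equal (@slice_mor _ _ _ _ _ _)) in Hn; refine (eq_trans _ Hn).
  simpl; do 2 f_equal; now apply slice_hom_ext.
- pose proof (@dprod_natural _ _ _ _ _ _ _ _ phiE _ _ _ _
    (pullback_total Q) (pullback_total Q')
    (@SliceHom _ _ _ _ (total h') (total h) (total (slice_mor l))
       (total_eq (slice_comm l)))
    (@SliceHom _ _ _ _ (total (pb_snd Q')) (total (pb_snd Q)) (total (slice_mor m))
       (total_eq (slice_comm m)))
    (total_eq H) (slice_total u)) as Hn.
  apply (f_equal (@slice_mor _ _ _ _ _ _)) in Hn; refine (eq_trans _ Hn).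
  simpl; do 2 f_equal; apply slice_hom_ext; simpl; now norm.
Qed.

Definition cob_dprod : dprod_bijection f g cob_dprod_pi :=
  DprodBijection
    (fun W h Q => bijective_of_inj_surj (@cob_dprod_fun_inj W h Q)
                    (@cob_dprod_fun_surj W h Q))
    cob_dprod_natural.

End DependentProduct.

(** A bijection [psi] in [A] is recorded along with [phi], so that preservation by the projection is
    known for this product before it is transferred to arbitrary ones. *)
Lemma cob_dprod_exists (X Y Z : G) (f : hom X Y) (g : hom Y Z) :
  fibG _ _ f -> fibG _ _ g ->
  exists (P : G) (pi : hom P Z) (phi : dprod_bijection f g pi)
    (psi : dprod_bijection (base f) (base g) (base pi)),
    fibG _ _ pi /\
    forall (W : G) (h : hom W Z) (Q : pullback h g)
      (HQ : is_pullback (base h) (base g) (base (pb_fst Q)) (base (pb_snd Q)))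
      (u : slice_hom h pi),
      dprod_fun psi (Pullback HQ) (slice_map proj u) =
      slice_map proj (dprod_fun phi Q u).
Proof.
intros Hf Hg.
destruct (ttfc_dprod HA (proj1 Hf) (proj1 Hg)) as [P [piA [HpiA [phiA]]]].
destruct (ttfc_dprod HE (proj2 Hf) (proj2 Hg)) as [R [piE [HpiE [phiE]]]].
destruct (tt_functor_dprod (fttfc_functor Hp) phiE (proj2 Hf) (proj2 Hg) HpiE)
  as [phiB HphiB].
destruct (ttfc_pullback HA piA (proj1 Hg)) as [D].
destruct (@comparison_exists _ _ _ f g Hg _ _ phiA _ piE phiB D) as [c Hc].
destruct (cartesian_lift_exists (fttfc_fibred Hp) c) as [N [e [k [Hk Hkc]]]].
exists (CobOb e), (cob_dprod_pi Hc Hkc), (cob_dprod Hg HphiB Hc Hk Hkc), phiA; split.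
- assert (Hpi : fibA (base (cob_dprod_pi Hc Hkc))) by exact HpiA.
  split; trivial; apply (fib_reindex Hp HpiE Hk).
  exact (cob_fib_total Hpi).
(* The base component of the constructed bijection is [phiA] by definition; only the proofs that the
   base square is a pullback have to be identified. *)
- intros W h Q HQ u; apply slice_hom_ext; simpl; unfold pullback_base.
  rewrite (proof_irrelevance _ HQ (proj1 (cob_pullback_elim Hg (pb_is_pullback Q)))).
  do 2 f_equal; now apply slice_hom_ext.
Qed.

(** * The type-theoretic structure of [F^*E] and of its projection *)

(** An arbitrary dependent product is isomorphic to the constructed one, and [psi] is transported
    along the base of the isomorphism. *)
Lemma cob_proj_dprods : preserves_dprods fibG proj.
Proof.
intros X Y Z P f g pi phi Hf Hg Hpi.
destruct (cob_dprod_exists Hf Hg) as [P' [pi' [phi' [psi [Hpi' Hpsi]]]]].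
assert (Hpb : forall (V : G) (h : hom V Z), inhabited (pullback h g)).
{ intros V h; destruct (cob_pullback_exists h Hg) as [V' [q1 [q2 [Hb Ht]]]].
  exact (inhabits (Pullback (cob_pullback_intro (proj1 Hg) Hb Ht))). }
destruct (dprod_unique phi phi' (Hpb _ pi) (Hpb _ pi')) as [a [Ha Hphi]].
destruct (dprod_transport psi (a := slice_map proj a) (is_iso_base Ha)) as [psi' Hpsi'].
exists psi'; intros W h Q HQ u.
rewrite Hpsi', Hphi, <- (Hpsi _ _ _ HQ); f_equal; now apply slice_hom_ext.
Qed.

Lemma cob_ttfc : is_ttfc fibG.
Proof.
assert (Hpb : forall (X Y Z : G) (f : hom X Z) (g : hom Y Z),
  fibG _ _ g -> inhabited (pullback f g)).
{ intros X Y Z f g Hg; destruct (cob_pullback_exists f Hg) as [V [q1 [q2 [Hb Ht]]]].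
  exact (inhabits (Pullback (cob_pullback_intro (proj1 Hg) Hb Ht))). }
split.
- destruct cob_terminal_exists as [T [HT _]]; now exists T.
- apply cob_fib_comp.
- apply cob_fib_iso.
- apply cob_fib_terminal.
- exact Hpb.
- intros X Y Z f g Q Hg.
  destruct (cob_pullback_elim Hg (pb_is_pullback Q)) as [Hb Ht]; split.
  + exact (ttfc_fib_pullback HA (Pullback Hb) (proj1 Hg)).
  + exact (ttfc_fib_pullback HE (Pullback Ht) (proj2 Hg)).
- intros X Y f; destruct (cob_factorization f) as [M [i [q [Hb [Ht [Hq Hf]]]]]].
  exists M, i, q; repeat split; trivial; try apply Hq; now apply cob_acof.
- intros X Y Z f g Hf Hg.
  destruct (cob_dprod_exists Hf Hg) as [P [pi [phi [_ [Hpi _]]]]].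
  now exists P, pi.
Qed.

Lemma cob_proj_tt_functor : is_tt_functor fibG fibA proj.
Proof.
split.
- exact cob_terminal_base.
- now intros X Y f [Hf _].
- intros X Y Z P f g p1 p2 Hg HP; apply (cob_pullback_elim Hg HP).
- exact cob_acof_base.
- exact cob_proj_dprods.
Qed.

End ChangeOfBaseTtfc.

Theorem mainTheorem5 (E B A : category)
    (fibE : mor_class E) (fibB : mor_class B) (fibA : mor_class A)
    (p : functor E B) (F : functor A B) :
  is_fibred_ttfc fibE fibB p ->
  is_ttfc fibA ->
  preserves_fibrations fibA fibB F ->
  preserves_pullbacks_of_fibrations fibA F ->
  preserves_acyclic_cofibrations fibA fibB F ->
  is_fibred_ttfc (levelwise p F fibA fibE) fibA (change_of_base_proj p F).
Proof.
intros Hp HA HFfib HFpb HFacof; split.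
- exact (cob_fibred (fttfc_fibred Hp)).
- exact (cob_ttfc Hp HA HFfib HFpb HFacof).
- exact HA.
- exact (cob_proj_tt_functor Hp HA HFfib HFpb HFacof).
- intros X Y f Hf Hs; split; trivial.
  apply (fttfc_cartesian_fib Hp).
  + exact (cob_cartesian_total (fttfc_fibred Hp) Hf).
  + exact (cob_fib_total Hp HFfib Hs).
- intros Z Y g J s t X eX c a Hg Hst Hs Hc Hct Has Hca.
  assert (Hsa : fibA _ _ (cob_base_mor a)).
  { destruct eX; unfold above in Has; simpl in Has; now rewrite Has. }
  split; trivial; apply (induced_fib Hp (cob_cartesian_total (fttfc_fibred Hp) Hc)).
  + exact (cob_fib_total Hp HFfib Hsa).
  + rewrite <- Hca in Hg; exact (proj2 Hg).
- intros X Y f Hf Hs; apply (cob_acof Hp Hs).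
  apply (fttfc_cartesian_acof Hp).
  + exact (cob_cartesian_total (fttfc_fibred Hp) Hf).
  + exact (cob_acof_total HFacof Hs).
Qed.
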